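(* Let $p$ be a prime and let $G$ be a finite $p$-group with $|G'|=p$ and $|G:Z(G)|=p^{2n}$. Then $$P_4(G)=\frac{1}{p^6}+\frac{p^5+p^3-p^2-1}{p^6}\,p^{-2n}+\frac{p^4-p^3-p+1}{p^4}\,p^{-4n}.$$ In particular, if $n=1$ then $P_4(G)=(p^4+p^3-1)/p^7$.
   Context: $P_4(G):=|\{(x_1,\dots,x_4)\in G^4 : x_ix_j=x_jx_i\ \text{for all } i,j\}|/|G|^4$. $G'$ is the commutator subgroup and $Z(G)$ the center. For a finite $p$-group with $|G'|=p$, the index $|G:Z(G)|$ is always of the form $p^{2n}$ with $n\ge1$. *)

(* Defs.v *)
From mathcomp Require Import all_boot all_order all_algebra all_fingroup all_solvable.

Set Implicit Arguments.
Unset Strict Implicit.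
Unset Printing Implicit Defensive.

Definition commuting_tuples (gT : finGroupType) (k : nat) (G : {set gT}) :
    {set k.-tuple gT} :=
  [set x : k.-tuple gT |
    [forall i, tnth x i \in G] &&
    [forall i, forall j, (tnth x i * tnth x j == tnth x j * tnth x i)%g]].

Definition commuting_prob (gT : finGroupType) (k : nat) (G : {set gT}) : rat :=
  (#|commuting_tuples k G|%:R / #|G|%:R ^+ k)%R.

(* Main.v *)
Require Import Defs.
From mathcomp Require Import all_boot all_order all_algebra all_fingroup all_solvable.
From mathcomp Require Import ring.

(** The proof counts commuting tuples by their first entry: a commuting
(k+1)-tuple of H starting with x is x followed by a commuting k-tuple of the
centralizer of x in H, so
  P_{k+1}(H) = |H|^-(k+1) * (sum over x in H of |C_H(x)|^k * P_k(C_H(x))).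

What makes this recursion closed is that, when H' lies in a central subgroup K
of prime order p, the number P_k(H) depends only on p, k and q = |H : Z(H)|.
For central x the centralizer is H itself.  For noncentral x the centralizer C
has index p in H ([index_cent1_prime]) and its center is larger than Z(H) by a
factor p ([index_center_cent1]); hence |C : Z(C)| = q / p^2, and C again has its
derived subgroup inside the central subgroup K.  In terms of the symplectic
space H / Z(H), passing to C replaces the space by x^perp modulo its radical
spanned by x.  A fraction 1/q of the elements of H being central, this gives
[commuting_probE], namely P_k(H) = f_k(q) with
  f_0 = 1,   f_{k+1}(q) = f_k(q) / q + (1 - 1/q) * p^-k * f_k(q / p^2).

In the theorem K = G' qualifies: it is normal of prime order in a p-group, so it
meets the center and is therefore central.  Expanding f_4 at q = p^(2n) is a
computation in the field of rationals. *)

Import GRing.Theory Num.Theory.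
Local Open Scope ring_scope.

(** * Commuting tuples and centralizers *)

Section CommutingTuples.
Local Open Scope group_scope.
Variable gT : finGroupType.
Implicit Types A H K : {group gT}.

(** The tail of a commuting tuple lies in the centralizer of its head; this is
the step that turns counting tuples of H into counting tuples of smaller
groups. *)
Lemma cons_commuting_tuples k (H : {set gT}) x (t : k.-tuple gT) :
  ([tuple of x :: t] \in commuting_tuples k.+1 H)
    = (x \in H) && (t \in commuting_tuples k 'C_H[x]).
Proof.
rewrite !inE; apply/andP/and3P.
  case=> /forallP tH /forallP tC.
  have cxt i : x * tnth t i = tnth t i * x.
    by have /forallP/(_ (lift ord0 i))/eqP := tC ord0; rewrite tnth0 tnthS.
  split; first by have := tH ord0; rewrite tnth0.
    apply/forallP=> i; rewrite inE; have := tH (lift ord0 i).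
    by rewrite tnthS => ->; apply/cent1P/esym/cxt.
  apply/forallP=> i; apply/forallP=> j.
  by have /forallP/(_ (lift ord0 j)) := tC (lift ord0 i); rewrite !tnthS.
case=> Hx /forallP tC /forallP tt.
have tH i : tnth t i \in H by have := tC i; rewrite inE => /andP[].
have cxt i : x * tnth t i = tnth t i * x.
  by have := tC i; rewrite inE => /andP[_ /cent1P].
split.
  by apply/forallP=> i; case: (unliftP ord0 i) => [j|] ->; rewrite ?tnth0 ?tnthS.
apply/forallP=> i; apply/forallP=> j.
case: (unliftP ord0 i) => [i'|] ->; case: (unliftP ord0 j) => [j'|] ->;
  rewrite ?tnth0 ?tnthS ?cxt //.
by have /forallP := tt i'; apply.
Qed.

Lemma card_commuting_tuples0 (H : {set gT}) : #|commuting_tuples 0 H| = 1%N.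
Proof.
rewrite (_ : commuting_tuples 0 H = setT) ?cardsT ?card_tuple //.
by apply/setP=> t; rewrite !inE; apply/andP; split; apply/forallP; case.
Qed.

Lemma card_commuting_tuplesS k (H : {set gT}) :
  #|commuting_tuples k.+1 H| = (\sum_(x in H) #|commuting_tuples k 'C_H[x]|)%N.
Proof.
rewrite -sum1_card (partition_big (@thead k gT) (mem H)) => [|t]; last first.
  by rewrite [t]tuple_eta cons_commuting_tuples theadE => /andP[].
apply: eq_bigr => x /= Hx; have {}Hx : x \in H := Hx; rewrite -sum1_card.
rewrite (reindex_onto (fun t : k.-tuple gT => [tuple of x :: t])
                      (fun t : k.+1.-tuple gT => [tuple of behead t])) => [|t].
  apply: eq_bigl => t; rewrite cons_commuting_tuples Hx theadE eqxx andbT.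
  by case: eqP => [_|/eqP/negP[]]; rewrite ?andbT //; apply/eqP/val_inj.
by case/andP=> _ /eqP <-; rewrite -tuple_eta.
Qed.

(** The conjugates of x by A are x times the commutators [x, a].  By centrality
of K, a |-> [x, a] is a homomorphism to K, and it is onto as soon as it is not
trivial, because K has prime order: so x ^: A is the whole coset x K.  The group
A acting on x is kept apart from H, because [index_center_cent1] lets a subgroup
act on an element lying outside it. *)
Lemma index_cent1_prime A H K x :
    A \subset H -> x \in H -> x \notin 'C(A) ->
    H^`(1) \subset K -> prime #|K| -> H \subset 'C(K) ->
  #|A : 'C_A[x]| = #|K|.
Proof.
move=> sAH Hx ncx sHK prK cKH; rewrite index_cent1 -(card_lcoset K x).
have [a Aa ncxa]: exists2 a, a \in A & [~ x, a] != 1.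
  apply/exists_inP; apply: contraR ncx; rewrite negb_exists_in => /forall_inP h.
  by apply/centP=> a Aa; apply/commgP; rewrite -[_ == _]negbK h.
have KR b : b \in A -> [~ x, b] \in K.
  by move=> Ab; apply: (subsetP sHK); rewrite mem_commg // (subsetP sAH).
congr #|pred_of_set _|; apply/eqP; rewrite eqEsubset; apply/andP; split.
  apply/subsetP=> _ /imsetP[b Ab ->].
  by rewrite conjg_mulR mem_lcoset mulKg KR.
apply/subsetP=> y; rewrite mem_lcoset => Ky.
(* A single commutator generates K, and [x, a]^i = [x, a^i]. *)
have defK: K :=: <[[~ x, a]]> by apply: nt_gen_prime; rewrite // !inE ncxa KR.
move: Ky; rewrite {1}defK => /cycleP[i def_y].
have cxa: commute a [~ x, a].
  by apply: (centsP cKH); rewrite ?KR // (subsetP sAH).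
apply/imsetP; exists (a ^+ i); first exact: groupX.
by rewrite conjg_mulR commgX // -def_y mulKVg.
Qed.

Lemma center_sub_cent1 (H : {group gT}) x :
  x \in H -> 'Z(H) \subset 'Z('C_H[x]).
Proof.
move=> Hx; apply/subsetP=> z /setIP[Hz /centP cz].
rewrite !in_setI Hz (introT cent1P (cz x Hx)) /=.
by apply/centP=> y /setIP[Hy _]; apply: cz.
Qed.

(** Choose g in H outside C = C_H(x).  The subgroup Z(C) does not centralize g,
since it contains x, so by [index_cent1_prime] its elements commuting with g
have index p in Z(C).  Those elements are the central ones of H: they commute
with C and with g, and C has prime index in H. *)
Lemma index_center_cent1 H K x :
    x \in H -> x \notin 'Z(H) ->
    H^`(1) \subset K -> prime #|K| -> H \subset 'C(K) ->
  #|'Z('C_H[x]) : 'Z(H)| = #|K|.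
Proof.
move=> Hx ncx sHK prK cKH.
have {}ncx: x \notin 'C(H) by apply: contra ncx; rewrite inE Hx.
have iC: #|H : 'C_H[x]| = #|K| by apply: (@index_cent1_prime H H).
have [g Hg ncg]: exists2 g, g \in H & g \notin 'C[x].
  by apply/subsetPn; rewrite sub_cent1.
have sZH: 'Z('C_H[x]) \subset H.
  by rewrite (subset_trans (center_sub _)) ?subsetIl.
have <-: 'C_('Z('C_H[x]))[g] = 'Z(H).
  apply/eqP; rewrite eqEsubset; apply/andP; split; last first.
    rewrite subsetI center_sub_cent1 //= sub_cent1.
    by rewrite (subsetP _ _ Hg) // centsC subsetIr.
  apply/subsetP=> y /setIP[Zy cyg].
  have Hy := subsetP sZH y Zy.
  rewrite inE Hy; apply: contraR ncg => ncy.
  (* If y were not central, C_H(y) would have the same index as C_H(x); as it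
     contains C_H(x), it would be equal to it, and g would commute with x. *)
  have iCy: #|H : 'C_H[y]| = #|K| by apply: (@index_cent1_prime H H).
  have sC: 'C_H[x] \subset 'C_H[y].
    by rewrite subsetI subsetIl sub_cent1; case/setIP: Zy.
  have /eqP eC: 'C_H[x] == 'C_H[y].
    rewrite eqEcard sC /= -(leq_pmul2r (prime_gt0 prK)).
    by rewrite -{1}iCy -{1}iC !Lagrange ?subsetIl.
  have: g \in 'C_H[y] by rewrite inE Hg cent1C.
  by rewrite -eC => /setIP[].
apply: (@index_cent1_prime _ H) => //.
apply: contra ncg => /centP cg; apply/cent1P/cg.
rewrite !in_setI Hx cent1id /=; apply/centP=> y /setIP[_].
by move/cent1P.
Qed.

End CommutingTuples.

(** * The recursion for the proportion of commuting tuples *)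

(** The proportion of commuting k-tuples as a function of the order p of a central
subgroup containing all commutators and of the index q of the center.  It takes
an arbitrary rational q, so that q / p ^+ 2 needs no divisibility. *)
Fixpoint commuting_prob_rec (p : rat) (k : nat) (q : rat) : rat :=
  if k is j.+1 then
    q^-1 * commuting_prob_rec p j q
    + (1 - q^-1) * p ^- j * commuting_prob_rec p j (q / p ^+ 2)
  else 1.

Lemma natr_indexg (gT : finGroupType) (H K : {group gT}) : K \subset H ->
  #|H : K|%g%:R = #|H|%:R / #|K|%:R :> rat.
Proof.
move=> sKH; rewrite -(Lagrange sKH) natrM mulrAC divff ?mul1r //.
by rewrite pnatr_eq0 -lt0n.
Qed.

(** The hypotheses bound the derived subgroup by K instead of prescribing it, so
that they pass to centralizers and the induction on k can apply to these.  When
H is abelian, q = 1 and the noncentral term has coefficient 0. *)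
Lemma commuting_probE (gT : finGroupType) (K H : {group gT}) (k : nat) :
    H^`(1)%g \subset K -> prime #|K| -> H \subset 'C(K)%g ->
  commuting_prob k H = commuting_prob_rec #|K|%:R k #|H : 'Z(H)|%g%:R.
Proof.
move=> + prK; elim: k H => [|k IHk] H sHK cKH.
  by rewrite /commuting_prob card_commuting_tuples0 expr0 divr1.
have nz (A : {group gT}) : #|A|%:R != 0 :> rat.
  by rewrite pnatr_eq0 -lt0n.
have sZH := center_sub H.
have count (A : {group gT}) :
    #|commuting_tuples k A|%:R = commuting_prob k A * #|A|%:R ^+ k.
  by rewrite divfK ?expf_neq0.
have central x : x \in 'Z(H)%g ->
    #|commuting_tuples k 'C_H[x]%g|%:R
      = commuting_prob_rec #|K|%:R k #|H : 'Z(H)|%g%:R * #|H|%:R ^+ k.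
  case/setIP=> _ cHx; rewrite -IHk // -count.
  congr (#|pred_of_set (commuting_tuples k _)|%:R).
  by apply/setIidPl; rewrite sub_cent1.
have noncentral x : x \in H :\: 'Z(H)%g ->
    #|commuting_tuples k 'C_H[x]%g|%:R
      = commuting_prob_rec #|K|%:R k (#|H : 'Z(H)|%g%:R / #|K|%:R ^+ 2)
        * (#|H|%:R / #|K|%:R) ^+ k.
  case/setDP=> Hx nZx.
  have sCH : 'C_H[x]%g \subset H := subsetIl _ _.
  have sZC : 'Z(H)%g \subset 'Z('C_H[x])%g by apply: center_sub_cent1.
  have iC : #|H : 'C_H[x]|%g = #|K|.
    apply: (@index_cent1_prime _ H H) => //.
    by apply: contra nZx => cHx; rewrite inE Hx.
  have iZ : #|'Z('C_H[x]) : 'Z(H)|%g = #|K| by apply: index_center_cent1.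
  have sC'K : ('C_H[x])^`(1)%g \subset K := subset_trans (dergS 1 sCH) sHK.
  rewrite (count 'C_H[x]%G) IHk ?(subset_trans sCH) //.
  rewrite !natr_indexg ?center_sub //.
  rewrite -(Lagrange sCH) -(Lagrange sZC) iC iZ !natrM.
  by congr (commuting_prob_rec _ _ _ * _ ^+ _); field; rewrite !nz.
rewrite /commuting_prob card_commuting_tuplesS natr_sum (big_setID 'Z(H)%g) /=.
rewrite (setIidPr sZH) (eq_bigr _ central) (eq_bigr _ noncentral).
rewrite !sumr_const cardsDS // -[X in X + _]mulr_natr -[X in _ + X]mulr_natr.
rewrite natrB ?subset_leq_card //.
move: (commuting_prob_rec _ k _) (commuting_prob_rec _ k _) => fq' fq.
rewrite natr_indexg //= (exprS #|H|%:R) expr_div_n.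
by field; rewrite !expf_neq0 ?nz.
Qed.

Lemma commuting_prob_rec4E (p q : rat) : p != 0 -> q != 0 ->
  commuting_prob_rec p 4 q =
    1 / p ^+ 6 + (p ^+ 5 + p ^+ 3 - p ^+ 2 - 1) / p ^+ 6 * q^-1
    + (p ^+ 4 - p ^+ 3 - p + 1) / p ^+ 4 * q ^- 2.
Proof. by move=> p0 q0 /=; field; rewrite p0 q0. Qed.

Theorem corollary7p6 (gT : finGroupType) (G : {group gT}) (p n : nat)
  (p_prime : prime p) (pG : (p.-group G)%g)
  (cardG' : #|(G^`(1))%g| = p) (indexZ : #|G : 'Z(G)|%g = (p ^ (2 * n))%N) :
  (commuting_prob 4 G =
     1 / p%:R ^+ 6
     + (p%:R ^+ 5 + p%:R ^+ 3 - p%:R ^+ 2 - 1) / p%:R ^+ 6 * p%:R ^- (2 * n)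
     + (p%:R ^+ 4 - p%:R ^+ 3 - p%:R + 1) / p%:R ^+ 4 * p%:R ^- (4 * n))
  /\ (n = 1%N ->
      commuting_prob 4 G = (p%:R ^+ 4 + p%:R ^+ 3 - 1) / p%:R ^+ 7).
Proof.
have p0 : p%:R != 0 :> rat by rewrite pnatr_eq0 -lt0n prime_gt0.
(* A normal subgroup of a p-group meets the center; here it has prime order. *)
have cGG' : G \subset 'C(G^`(1))%g.
  rewrite centsC (subset_trans _ (subsetIr G _)) // prime_meetG ?cardG' //.
  rewrite meet_center_nil ?(pgroup_nil pG) ?der_normal //.
  by rewrite -cardG_gt1 cardG' prime_gt1.
have prG' : prime #|G^`(1)|%g by rewrite cardG'.
have -> : commuting_prob 4 G = commuting_prob_rec p%:R 4 (p%:R ^+ (2 * n)).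
  by rewrite (@commuting_probE _ (G^`(1))%G) //= cardG' indexZ natrX.
rewrite commuting_prob_rec4E ?expf_neq0 // -exprM mulnAC.
by split=> // ->; field.
Qed.
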